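(* Let $M=\langle W,R,\varphi\rangle$ be a CO-model, let $\leq_{EM}$ be the entrenchment ordering determined by $M$ on the sentences of $\mathbf{L}_{CPL}$, and define $A \geq_N B$ iff $B \leq_{EM} A$, for $A,B\in\mathbf{L}_{CPL}$. Then $\geq_N$ is a qualitative necessity ordering; that is, for all $A,B,C\in\mathbf{L}_{CPL}$: (N1) $A \geq_N A$; (N2) $A \geq_N B$ or $B \geq_N A$; (N3) if $A \geq_N B$ and $B \geq_N C$ then $A \geq_N C$; (N4) $\top >_N \bot$ (i.e. $\top\geq_N\bot$ and not $\bot\geq_N\top$); (N5) $\top \geq_N A$; (N6) if $B \geq_N C$ then $A \wedge B \geq_N A \wedge C$.
   Context: Language: $\mathbf{P}$ is a denumerable set of propositional variables; $\mathbf{L}$ is the language built from $\mathbf{P}$ with connectives $\neg,\supset$ (material implication), $\Box$ and $\overleftarrow{\Box}$ (both unary modal operators), with $\wedge,\vee,\equiv,\top,\bot$ defined as usual. $\mathbf{L}_{CPL}$ is the purely propositional (modality-free) sublanguage. CO-model: a triple $M=\langle W,R,\varphi\rangle$ where $W$ is a nonempty set (of worlds), $R$ is a binary relation on $W$ that is transitive and totally connected (for all $v,w\in W$, $wRv$ or $vRw$; in particular $R$ is reflexive), and $\varphi:\mathbf{P}\to 2^W$ ($\varphi(A)$ is the set of worlds where $A$ is true). Truth at a world: $M\models_w\alpha$ is defined as usual for variables and classical connectives; $M\models_w\Box\alpha$ iff $M\models_v\alpha$ for every $v$ with $wRv$; $M\models_w\overleftarrow{\Box}\alpha$ iff $M\models_v\alpha$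 for every $v$ such that not $wRv$. $M\models\alpha$ means $M\models_w\alpha$ for every $w\in W$. Abbreviations: $\Diamond\alpha:=\neg\Box\neg\alpha$ and $\overleftrightarrow{\Box}\alpha:=\Box\alpha\wedge\overleftarrow{\Box}\alpha$ (so $\overleftrightarrow{\Box}\alpha$ holds at a world iff $\alpha$ holds at all worlds of $W$). Plausibility ordering determined by $M$: $A\leq_{PM}B$ iff $M\models\overleftrightarrow{\Box}(B\supset\Diamond A)$ (''$A$ is at least as plausible as $B$''). Entrenchment ordering determined by $M$: $B\leq_{EM}A$ iff $\neg B\leq_{PM}\neg A$ (''$A$ is at least as entrenched as $B$''); equivalently, $M\models\overleftrightarrow{\Box}(\neg A\supset\Diamond\neg B)$. *)

(* Defs.v *)
From Corelib Require Import ssreflect ssrfun.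

Set Implicit Arguments.
Unset Strict Implicit.
Unset Printing Implicit Defensive.

Definition denumerable (P : Type) : Prop := exists f : nat -> P, bijective f.

Inductive form (P : Type) : Type :=
| Var (p : P)
| Neg (a : form P)
| Imp (a b : form P)
| Box (a : form P)
| LBox (a : form P).

(* The sublanguage L_CPL of modality-free sentences. *)
Fixpoint propositional (P : Type) (a : form P) : Prop :=
  match a with
  | Var _ => True
  | Neg b => propositional b
  | Imp b c => propositional b /\ propositional c
  | Box _ | LBox _ => False
  end.

Definition And (P : Type) (a b : form P) : form P := Neg (Imp a (Neg b)).

(* The primitive connectives provide no constant, so top and bottom are
   abbreviations that depend on an arbitrarily chosen variable p. *)
Definition Top (P : Type) (p : P) : form P := Imp (Var p) (Var p).
Definition Bot (P : Type) (p : P) : form P := Neg (Top p).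

Definition Dia (P : Type) (a : form P) : form P := Neg (Box (Neg a)).
Definition LRBox (P : Type) (a : form P) : form P := And (Box a) (LBox a).

Record COmodel (P : Type) : Type := {
  world : Type;
  acc : world -> world -> Prop;
  val : P -> world -> Prop;
  world_nonempty : inhabited world;
  acc_trans : forall u v w, acc u v -> acc v w -> acc u w;
  acc_total : forall v w, acc w v \/ acc v w
}.

Fixpoint truth (P : Type) (M : COmodel P) (w : world M) (a : form P) : Prop :=
  match a with
  | Var p => val p w
  | Neg b => ~ truth w b
  | Imp b c => truth w b -> truth w c
  | Box b => forall v : world M, acc w v -> truth v b
  | LBox b => forall v : world M, ~ acc w v -> truth v b
  end.

Definition valid (P : Type) (M : COmodel P) (a : form P) : Prop :=
  forall w : world M, truth w a.

(* le_PM M A B: A is at least as plausible as B. *)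
Definition le_PM (P : Type) (M : COmodel P) (A B : form P) : Prop :=
  valid M (LRBox (Imp B (Dia A))).

(* le_EM M B A: A is at least as entrenched as B. *)
Definition le_EM (P : Type) (M : COmodel P) (B A : form P) : Prop :=
  le_PM M (Neg B) (Neg A).

Definition ge_N (P : Type) (M : COmodel P) (A B : form P) : Prop :=
  le_EM M B A.

(* Only the restriction of ge to L_CPL matters: every quantifier ranges over
   modality-free sentences. *)
Record qualitative_necessity (P : Type) (p : P)
    (ge : form P -> form P -> Prop) : Prop := {
  N1 : forall A, propositional A -> ge A A;
  N2 : forall A B, propositional A -> propositional B -> ge A B \/ ge B A;
  N3 : forall A B C,
    propositional A -> propositional B -> propositional C ->
    ge A B -> ge B C -> ge A C;
  N4 : ge (Top p) (Bot p) /\ ~ ge (Bot p) (Top p);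
  N5 : forall A, propositional A -> ge (Top p) A;
  N6 : forall A B C,
    propositional A -> propositional B -> propositional C ->
    ge B C -> ge (And A B) (And A C)
}.

(* Main.v *)
Require Import Defs.
From Stdlib Require Import Classical.

(** Unfolded semantically, entrenchment compares sets of refuting worlds: [A] is at least as
    entrenched as [B] when each world refuting [A] sees one refuting [B] ([ge_NP]). The axioms then
    reflect the frame: reflexivity, totality and transitivity of [acc] yield N1, N2 and N3,
    nonemptiness yields N4, and N5 is vacuous because no world refutes [Top p]. *)

Lemma truth_And (P : Type) (M : COmodel P) (w : world M) (a b : form P) :
  truth w (And a b) <-> truth w a /\ truth w b.
Proof. simpl; tauto. Qed.

Lemma truth_Dia (P : Type) (M : COmodel P) (w : world M) (a : form P) :
  truth w (Dia a) <-> exists v, acc w v /\ truth v a.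
Proof.
  simpl; split.
  - intro H; apply NNPP; intro N; apply H; intros v wv va.
    apply N; exists v; auto.
  - intros [v [wv va]] H; exact (H v wv va).
Qed.

(** Each world is either seen or not seen from [w], so the two boxes together reach all worlds, [w]
    itself included. *)
Lemma valid_LRBox (P : Type) (M : COmodel P) (a : form P) :
  valid M (LRBox a) <-> valid M a.
Proof.
  unfold valid, LRBox; split; intros H w.
  - destruct (proj1 (truth_And _ M w _ _) (H w)) as [Hb Hl].
    destruct (classic (acc w w)) as [r | r]; [exact (Hb w r) | exact (Hl w r)].
  - apply truth_And; split; intros v _; apply H.
Qed.

Lemma ge_NP (P : Type) (M : COmodel P) (A B : form P) :
  ge_N M A B <->
  forall w : world M, ~ truth w A -> exists v, acc w v /\ ~ truth v B.
Proof.
  unfold ge_N, le_EM, le_PM; rewrite valid_LRBox.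
  split; intros H w nA.
  - exact (proj1 (truth_Dia _ M w (Neg B)) (H w nA)).
  - exact (proj2 (truth_Dia _ M w (Neg B)) (H w nA)).
Qed.

Lemma acc_refl (P : Type) (M : COmodel P) (w : world M) : acc w w.
Proof. destruct (acc_total w w); assumption. Qed.

Lemma ge_N_total (P : Type) (M : COmodel P) (A B : form P) :
  ge_N M A B \/ ge_N M B A.
Proof.
  destruct (classic (ge_N M A B)) as [H | H]; [left; exact H | right].
  rewrite ge_NP in H; apply not_all_ex_not in H; destruct H as [w H].
  apply imply_to_and in H; destruct H as [nA H].
  (* The counterexample [w] to the first comparison refutes [A] and sees no world refuting [B]; by
     totality every such world must see [w], which serves as a uniform witness. *)
  apply ge_NP; intros u nB; exists w; split; [| exact nA].
  destruct (acc_total u w) as [wu | uw]; [| exact uw].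
  destruct H; exists u; auto.
Qed.

Lemma ge_N_trans (P : Type) (M : COmodel P) (A B C : form P) :
  ge_N M A B -> ge_N M B C -> ge_N M A C.
Proof.
  rewrite !ge_NP; intros AB BC w nA.
  destruct (AB w nA) as [v [wv nB]]; destruct (BC v nB) as [u [vu nC]].
  exists u; split; [exact (acc_trans wv vu) | exact nC].
Qed.

Lemma ge_N_And (P : Type) (M : COmodel P) (A B C : form P) :
  ge_N M B C -> ge_N M (And A B) (And A C).
Proof.
  rewrite !ge_NP; intros BC w nAB; rewrite truth_And in nAB.
  (* If [A] holds at [w], then [B] fails there and the hypothesis applies; otherwise [w] already
     refutes the second conjunction and sees itself. *)
  destruct (classic (truth w A)) as [a | nA].
  - destruct (BC w (fun b => nAB (conj a b))) as [v [wv nC]].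
    exists v; rewrite truth_And; tauto.
  - exists w; rewrite truth_And; split; [apply acc_refl | tauto].
Qed.

Theorem theorem3 (P : Type) (HP : denumerable P) (p : P) (M : COmodel P) :
  qualitative_necessity p (ge_N M).
Proof.
  assert (top : forall A, ge_N M (Top p) A).
  { intro A; apply ge_NP; intros w nT; simpl in nT; tauto. }
  split.
  - intros A _; apply ge_NP; intros w nA; exists w.
    split; [apply acc_refl | exact nA].
  - intros A B _ _; apply ge_N_total.
  - intros A B C _ _ _; apply ge_N_trans.
  - split; [apply top |].
    (* Any world refutes [Bot p], so it would have to see one refuting [Top p]. *)
    rewrite ge_NP; intro H; destruct (world_nonempty M) as [w].
    destruct (H w) as [v [_ nT]]; simpl in *; tauto.
  - intros A _; apply top.
  - intros A B C _ _ _; apply ge_N_And.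
Qed.
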